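(* Let $X$ be a centered log-concave random variable. If $q$ is an odd integer and $p$ is a real number such that $1<p<q$, then $$\frac{\lvert\mathbb{E}[X^{q}]\rvert^{\frac{1}{q}}}{\lVert X\rVert_{p}}\leq\frac{\lvert\mathbb{E}[\Gamma^{q}]\rvert^{\frac{1}{q}}}{\lVert\Gamma\rVert_{p}},$$ with equality if and only if $X$ coincides with $\Gamma$ in law, where $\Gamma$ is a random variable with density $g(x)=e^{-(x+1)}$ supported on $[-1,\infty)$.
   Context: A real random variable $X$ is log-concave if it has a density $f_X$ with respect to Lebesgue measure such that $\log f_X$ is concave on the support of $f_X$; it is centered if $\mathbb{E}[X]=0$. $\|X\|_r=(\mathbb{E}|X|^r)^{1/r}$.
   Formalization: Equality is characterized as X coinciding in law with cΓ for some real c ≠ 0, instead of with Γ itself, since both sides are invariant under nonzero scaling and e.g. X = 2Γ or X = −Γ also attains equality. *)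

(* Defs.v *)
From HB Require Import structures.
From mathcomp Require Import all_boot all_order all_algebra.
From mathcomp Require Import all_classical all_reals all_analysis.

Set Implicit Arguments.
Unset Strict Implicit.
Unset Printing Implicit Defensive.

Import Order.TTheory GRing.Theory Num.Theory.
Import numFieldNormedType.Exports.

Local Open Scope classical_set_scope.
Local Open Scope ring_scope.

Definition has_density (R : realType) (d : measure_display)
    (T : measurableType d) (P : probability T R) (X : {RV P >-> R})
    (f : R -> R) : Prop :=
  [/\ measurable_fun [set: R] f,
      forall x, 0 <= f x &
      forall A : set R, measurable A ->
        distribution P X A = (\int[lebesgue_measure]_(x in A) (f x)%:E)%E].

(* [ln 0 = 0] in the library, so concavity of [ln \o f] has to be restricted to
   the support.  [convex_function D] only constrains values at convex
   combinations of points of [D]; convexity of [D] itself, which is part of the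
   meaning of "concave on [D]", is a separate condition. *)
Definition log_concave_fun (R : realType) (f : R -> R) : Prop :=
  let supp : set R := [set x | 0 < f x] in
  convex_set (supp : set (convex_lmodType R^o)) /\
  convex_function (supp : set (convex_lmodType R^o)) (fun x => - ln (f x)).

Definition log_concave (R : realType) (d : measure_display)
    (T : measurableType d) (P : probability T R) (X : {RV P >-> R}) : Prop :=
  exists f : R -> R, has_density X f /\ log_concave_fun f.

Definition centered (R : realType) (d : measure_display)
    (T : measurableType d) (P : probability T R) (X : {RV P >-> R}) : Prop :=
  ('E_P[X] = 0)%E.

Definition same_law (R : realType) (d d' : measure_display)
    (T : measurableType d) (T' : measurableType d')
    (P : probability T R) (P' : probability T' R)
    (X : {RV P >-> R}) (Y : {RV P' >-> R}) : Prop :=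
  forall A : set R, measurable A -> distribution P X A = distribution P' Y A.

Definition shifted_exponential_pdf (R : realType) (x : R) : R :=
  if -1 <= x then expR (- (x + 1)) else 0.

Definition moment_ratio (R : realType) (d : measure_display)
    (T : measurableType d) (P : probability T R) (X : {RV P >-> R})
    (q : nat) (p : R) : \bar R :=
  (`| 'E_P[fun w => (X w ^+ q)%R] | `^ (q%:R^-1)
     / 'N[P]_(p%:E)[EFin \o X])%E.

(* Main.v *)
From HB Require Import structures.
Require Import Defs.
From mathcomp Require Import all_boot all_order all_algebra.
From mathcomp Require Import all_classical all_reals all_analysis.
From mathcomp Require Import measurable_realfun ring lra.
Import Order.TTheory GRing.Theory Num.Theory.
Import numFieldNormedType.Exports.
Set Implicit Arguments.
Unset Strict Implicit.
Unset Printing Implicit Defensive.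

(** The proof is a crossing argument between two densities.

    The ratio does not change when X is multiplied by a nonzero constant, so X
    may be scaled, by a constant of suitable sign, until its p-th absolute
    moment is that of Gamma and its q-th moment is nonnegative.  Let f be the
    density of X after scaling and g the density of Gamma.  The claim becomes
    E X^q <= E Gamma^q, with equality only if f = g almost everywhere.

    The functions f and g have the same integral against 1, x and |x|^p, so
    for every test function k x = a + b x + c |x|^p + e x^q the integral of
    k (g - f) is e (E Gamma^q - E X^q).  It therefore suffices to find such a
    k, with e >= 0, that is positive where f < g and negative where f > g, up
    to finitely many points ([opposes]): if E X^q >= E Gamma^q, then k (g - f)
    is almost everywhere nonnegative with integral at most 0, hence f = g
    almost everywhere ([opposes_same_law]).

    The signs of f - g are easy to control.  To the left of -1 the function g
    vanishes, so f - g >= 0.  On [-1, +oo) the function ln g is affine, so ln f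
    - ln g is concave and f > g on an interval.  Hence f - g has at most the
    sign pattern +, -, +, - from left to right.

    A test function has the opposite pattern -, +, -, + as soon as it vanishes
    at three points, and the three points can be prescribed ([test_fun_three]).
    The reason is that, with e = 1, its derivative is b + c p w + q |w|^r in
    the variable w = sgn x |x|^(p-1), an increasing function of x, where
    r = (q-1)/(p-1) > 1; this is where q being odd enters, for it makes
    x^(q-1) = |x|^(q-1).  Thus the derivative is a strictly convex function of
    w and has at most two zeros, between which it is negative ([valley]), and
    the test function increases, decreases and increases again.  When f - g
    has fewer sign changes, a constant, an affine function, or an affine
    function minus |x|^p does the same job
    ([exists_opposing_test_fun]).

    All moments are finite because a log-concave density has exponentially
    decaying tails ([log_concave_tail]). *)

Local Open Scope classical_set_scope.
Local Open Scope ring_scope.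

(** * Sign patterns of functions with few critical points *)

(** The odd extension of x^s, so that |x|^p has derivative p * sgpow (p - 1) x
    on the whole line. *)
Definition sgpow (R : realType) (s x : R) : R := Num.sg x * `|x| `^ s.

(** The sign pattern +, -, + of a strictly convex function with two zeros, in a
    form that survives an increasing change of variable, unlike convexity
    itself. *)
Definition valley (R : realType) (F : R -> R) : Prop :=
  forall a b, a < b -> F a = 0 -> F b = 0 ->
  forall x, [/\ x < a -> 0 < F x, a < x < b -> F x < 0 & b < x -> 0 < F x].

Lemma mvt (R : realType) (F dF : R -> R) (a b : R) :
  (forall x : R, is_derive x (1:R) F (dF x)) -> a < b ->
  exists2 c, a < c < b & F b - F a = dF c * (b - a).
Proof.
move=> hF ab.
have cF : {within `[a, b], continuous F}.
  apply: derivable_within_continuous => x _.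
  by case: (hF x).
have [c cab ->] := MVT ab (fun x _ => hF x) cF.
by exists c => //; move: cab; rewrite in_itv.
Qed.

Lemma rolle0 (R : realType) (F dF : R -> R) (a b : R) :
  (forall x : R, is_derive x (1:R) F (dF x)) -> a < b -> F a = 0 -> F b = 0 ->
  exists2 c, a < c < b & dF c = 0.
Proof.
move=> hF ab Fa Fb; have [c cab] := mvt hF ab; rewrite Fa Fb subr0.
move=> /esym/eqP; rewrite mulf_eq0 subr_eq0 (gt_eqF ab) orbF => /eqP.
by exists c.
Qed.

(** The derivative vanishes between the two zeros, hence changes sign there
    once, from negative to positive. *)
Lemma valley_of_increasing_derive (R : realType) (F dF : R -> R) :
  (forall x : R, is_derive x (1:R) F (dF x)) -> {homo dF : x y / x < y} -> valley F.
Proof.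
move=> hF inc a b ab Fa Fb x.
have [c /andP[ac cb] dc] := rolle0 hF ab Fa Fb.
split=> [xa|/andP[ax xb]|bx].
- have [y /andP[xy ya]] := mvt hF xa; rewrite Fa => E.
  have : dF y < 0 by rewrite -dc; apply: inc; lra.
  by nra.
- have [xc|cx] := leP x c.
    have [y /andP[xy ya]] := mvt hF ax; rewrite Fa => E.
    have : dF y < 0 by rewrite -dc; apply: inc; lra.
    by nra.
  have [y /andP[xy ya]] := mvt hF xb; rewrite Fb => E.
  have : 0 < dF y by rewrite -dc; apply: inc; lra.
  by nra.
- have [y /andP[xy ya]] := mvt hF bx; rewrite Fb => E.
  have : 0 < dF y by rewrite -dc; apply: inc; lra.
  by nra.
Qed.

(** By Rolle, the derivative vanishes between t1 and t2 and between t2 and t3.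
    Being a valley it has no other zero, so F increases, decreases and
    increases again. *)
Lemma three_zeros (R : realType) (F dF : R -> R) (t1 t2 t3 : R) :
  (forall x : R, is_derive x (1:R) F (dF x)) -> valley dF ->
  t1 < t2 -> t2 < t3 -> F t1 = 0 -> F t2 = 0 -> F t3 = 0 ->
  forall x, [/\ x < t1 -> F x < 0, t1 < x < t2 -> 0 < F x,
    t2 < x < t3 -> F x < 0 & t3 < x -> 0 < F x].
Proof.
move=> hF val t12 t23 F1 F2 F3 x.
have [c /andP[t1c ct2] dc] := rolle0 hF t12 F1 F2.
have [e /andP[t2e et3] de] := rolle0 hF t23 F2 F3.
have ce : c < e by lra.
have V := val _ _ ce dc de.
split=> [xt|/andP[tx xt]|/andP[tx xt]|tx].
- have [y /andP[xy ya]] := mvt hF xt; rewrite F1 => E.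
  have [+ _ _] := V y; nra.
- have [xc|cx] := leP x c.
    have [y /andP[xy ya]] := mvt hF tx; rewrite F1 => E.
    have [+ _ _] := V y; nra.
  have [y /andP[xy ya]] := mvt hF xt; rewrite F2 => E.
  have [_ + _] := V y; have -> : c < y < e by lra.
  by move=> /(_ isT); nra.
- have [xc|cx] := leP x e.
    have [y /andP[xy ya]] := mvt hF tx; rewrite F2 => E.
    have [_ + _] := V y; have -> : c < y < e by lra.
    by move=> /(_ isT); nra.
  have [y /andP[xy ya]] := mvt hF xt; rewrite F3 => E.
  have [_ _] := V y; nra.
- have [y /andP[xy ya]] := mvt hF tx; rewrite F3 => E.
  have [_ _] := V y; nra.
Qed.

Lemma sgpow_pos (R : realType) (s x : R) : 0 < x -> sgpow s x = x `^ s.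
Proof. by move=> x0; rewrite /sgpow gtr0_sg// mul1r gtr0_norm. Qed.

Lemma sgpow_neg (R : realType) (s x : R) : x < 0 -> sgpow s x = - (- x) `^ s.
Proof. by move=> x0; rewrite /sgpow ltr0_sg// mulN1r ltr0_norm. Qed.

Lemma sgpow0 (R : realType) (s : R) : sgpow s 0 = 0.
Proof. by rewrite /sgpow sgr0 mul0r. Qed.

Lemma norm_sgpow (R : realType) (s x : R) : s != 0 -> `|sgpow s x| = `|x| `^ s.
Proof.
move=> s0; rewrite /sgpow normrM [`|_ `^ _|]ger0_norm ?powR_ge0// normr_sg.
by have [->|x0] := eqVneq x 0; rewrite ?mul0r ?mul1r// normr0 powR0.
Qed.

Lemma sgpow_increasing (R : realType) (s : R) : 0 < s ->
  {homo sgpow s : x y / x < y}.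
Proof.
move=> s0 x y xy.
have pw a b : 0 <= a -> a < b -> a `^ s < b `^ s.
  by move=> a0 ab; apply: gt0_ltr_powR => //; rewrite nnegrE; lra.
have [x0|x0|x0] := ltgtP x 0; have [y0|y0|y0] := ltgtP y 0; try lra.
- by rewrite !sgpow_neg// ltrN2; apply: pw; lra.
- rewrite (sgpow_neg _ x0) (sgpow_pos _ y0).
  have := powR_gt0 s y0; have /(powR_gt0 s): 0 < - x by lra.
  lra.
- rewrite y0 sgpow0 (sgpow_neg _ x0).
  have /(powR_gt0 s): 0 < - x by lra.
  lra.
- by rewrite !sgpow_pos//; apply: pw; lra.
- by rewrite x0 sgpow0 (sgpow_pos _ y0); apply: powR_gt0.
Qed.

(** At 0 the difference quotient of |x|^p is sgpow (p - 1), which tends to 0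
    because p > 1. *)
Lemma is_derive_norm_powR (R : realType) (p x : R) : 1 < p ->
  is_derive x 1 (fun y : R => `|y| `^ p) (p * sgpow (p - 1) x).
Proof.
move=> p1; have [x0|x0|->] := ltgtP x 0.
- have x0' : 0 < - x by lra.
  have E : (fun y : R => (- y) `^ p) = (fun y : R => y `^ p) \o -%R by [].
  apply: (@near_eq_is_derive _ _ _ (fun y : R => (- y) `^ p)).
  + near=> y; rewrite ltr0_norm//.
    by near: y; exact: lt_nbhsl.
  + have H : is_derive (- x) (1 : R) (fun y : R => y `^ p) (p * (- x) `^ (p - 1)).
      exact: is_derive1_powR.
    rewrite E; apply: is_derive_eq.
    by rewrite sgpow_neg// /GRing.scale/=; ring.
- apply: (@near_eq_is_derive _ _ _ (fun y : R => y `^ p)).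
  + near=> y; rewrite gtr0_norm//.
    by near: y; exact: lt_nbhsr.
  + by rewrite sgpow_pos//; exact: is_derive1_powR.
- rewrite sgpow0 mulr0.
  apply/is_derive1_caratheodory; exists (sgpow (p - 1)); split.
  + move=> z; rewrite normr0 powR0 ?subr0; last by lra.
    rewrite /sgpow mulrAC mulrC.
    have -> : Num.sg z * z = `|z| by rewrite normrEsg.
    by rewrite mulrC mulr_powRB1//; lra.
  + have : sgpow (p - 1) y @[y --> (0 : R)] --> sgpow (p - 1) 0; last by [].
    rewrite sgpow0; apply/cvgrPdist_lt => e e0; near=> z.
    rewrite sub0r normrN norm_sgpow; last by lra.
    have -> : e = (e `^ (p - 1)^-1) `^ (p - 1).
      by rewrite -powRrM mulVf ?powRr1//; lra.
    apply: gt0_ltr_powR; rewrite ?nnegrE//; first by lra.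
      exact: powR_ge0.
    near: z; exists (e `^ (p - 1)^-1); first exact: powR_gt0.
    by move=> y /=; rewrite sub0r normrN.
  + by rewrite sgpow0.
Unshelve. all: by end_near. Qed.

(** * Test functions *)

Lemma valley_powR_line (R : realType) (r C b m : R) : 1 < r -> 0 < C ->
  valley (fun y => C * `|y| `^ r - b - m * y).
Proof.
move=> r1 C0.
apply: (@valley_of_increasing_derive _ _ (fun y => C * (r * sgpow (r - 1) y) - m)).
  move=> x; have H := is_derive_norm_powR x r1.
  apply: is_derive_eq; rewrite /GRing.scale/=; ring.
move=> x y xy; rewrite ltrD2r ltr_pM2l// ltr_pM2l; last by lra.
by apply: sgpow_increasing => //; lra.
Qed.

Lemma valley_comp (R : realType) (G w : R -> R) :
  {homo w : x y / x < y} -> valley G -> valley (G \o w).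
Proof.
move=> wi vG a b ab Ga Gb x; have [h1 h2 h3] := vG _ _ (wi _ _ ab) Ga Gb (w x).
split=> [xa|/andP[ax xb]|bx] /=.
- exact/h1/wi.
- by apply: h2; rewrite !wi.
- exact/h3/wi.
Qed.

Lemma even_exprE (R : realType) (n : nat) (x : R) : ~~ odd n -> x ^+ n = `|x| ^+ n.
Proof. by move=> on; rewrite -normrX ger0_norm// exprn_even_ge0. Qed.

(** The derivative of a test function, seen as a function of
    w = sgpow (p - 1) x: since q - 1 is even, x^(q-1) = |w|^r with
    r = (q-1)/(p-1) > 1, and the whole is q |w|^r plus an affine function of w. *)
Lemma valley_derive (R : realType) (q : nat) (p b c : R) :
  odd q -> 1 < p -> p < q%:R ->
  valley (fun x => b + c * (p * sgpow (p - 1) x) + q%:R * x ^+ q.-1).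
Proof.
move=> oq p1 pq.
have q0 : (0 < q)%N by case: q oq {pq}.
have qE : (q.-1)%:R = q%:R - 1 :> R by rewrite -[in RHS](prednK q0) -natr1; ring.
pose r := (q%:R - 1) / (p - 1).
have r1 : 1 < r by rewrite /r ltr_pdivlMr; lra.
have -> : (fun x => b + c * (p * sgpow (p - 1) x) + q%:R * x ^+ q.-1) =
  (fun y => q%:R * `|y| `^ r - (- b) - (- (c * p)) * y) \o sgpow (p - 1).
  apply/funext => x /=; rewrite norm_sgpow; last by lra.
  rewrite -powRrM /r [(p - 1) * _]mulrC divfK; last by lra.
  have eq1 : ~~ odd q.-1 by rewrite -oddS prednK.
  by rewrite -qE powR_mulrn// (even_exprE x eq1); ring.
apply: valley_comp; first by apply: sgpow_increasing; lra.
by apply: valley_powR_line => //; rewrite ltr0n.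
Qed.

Definition test_fun (R : realType) (p : R) (q : nat) (a b c e x : R) : R :=
  a + b * x + c * `|x| `^ p + e * x ^+ q.

(** |x|^p minus its chord between t1 and t2. *)
Lemma test_fun_convex (R : realType) (p : R) (q : nat) (t1 t2 : R) :
  1 < p -> t1 < t2 -> exists a b, forall x,
  [/\ x < t1 -> 0 < test_fun p q a b 1 0 x,
      t1 < x < t2 -> test_fun p q a b 1 0 x < 0 &
      t2 < x -> 0 < test_fun p q a b 1 0 x].
Proof.
move=> p1 t12.
pose m := (`|t2| `^ p - `|t1| `^ p) / (t2 - t1).
pose b := `|t1| `^ p - m * t1.
have V := @valley_powR_line _ p 1 b m p1 ltr01.
have E1 : 1 * `|t1| `^ p - b - m * t1 = 0 by rewrite /b; ring.
have E2 : 1 * `|t2| `^ p - b - m * t2 = 0.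
  rewrite /b /m; field; lra.
exists (- b), (- m) => x.
rewrite /test_fun (_ : - b + - m * x + 1 * `|x| `^ p + 0 * x ^+ q =
   1 * `|x| `^ p - b - m * x); first exact: V t12 E1 E2 x.
by ring.
Qed.

(** Subtract from x^q and from |x|^p their chords between t1 and t3.  The second
    difference is negative at t2 by strict convexity, so a multiple of it can
    cancel the first one at t2. *)
Lemma test_fun_three (R : realType) (p : R) (q : nat) (t1 t2 t3 : R) :
  odd q -> 1 < p -> p < q%:R -> t1 < t2 -> t2 < t3 -> exists a b c, forall x,
  [/\ x < t1 -> test_fun p q a b c 1 x < 0,
      t1 < x < t2 -> 0 < test_fun p q a b c 1 x,
      t2 < x < t3 -> test_fun p q a b c 1 x < 0 &
      t3 < x -> 0 < test_fun p q a b c 1 x].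
Proof.
move=> oq p1 pq t12 t23.
have t13 := lt_trans t12 t23.
(* slopes of the chords of |x|^p and x^q between t1 and t3 *)
pose m := (`|t3| `^ p - `|t1| `^ p) / (t3 - t1).
pose n := (t3 ^+ q - t1 ^+ q) / (t3 - t1).
have V := @valley_powR_line _ p 1 (`|t1| `^ p - m * t1) m p1 ltr01.
have E1 : 1 * `|t1| `^ p - (`|t1| `^ p - m * t1) - m * t1 = 0 by ring.
have E2 : 1 * `|t3| `^ p - (`|t1| `^ p - m * t1) - m * t3 = 0.
  by rewrite /m; field; lra.
have [_ D _] := V _ _ t13 E1 E2 t2.
have {D}: 1 * `|t2| `^ p - (`|t1| `^ p - m * t1) - m * t2 < 0.
  by apply: D; rewrite t12.
set D := (X in X < 0) => D0.
pose c := - (t2 ^+ q - t1 ^+ q - n * (t2 - t1)) / D.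
exists (- t1 ^+ q + n * t1 - c * (`|t1| `^ p - m * t1)), (- n - c * m), c.
set a := (X in test_fun _ _ X); set b := (X in test_fun _ _ _ X).
have h2 : test_fun p q a b c 1 t2 = 0.
  have -> : test_fun p q a b c 1 t2 = t2 ^+ q - t1 ^+ q - n * (t2 - t1) + c * D.
    by rewrite /test_fun /a /b /D; ring.
  by rewrite /c; field; lra.
have h1 : test_fun p q a b c 1 t1 = 0 by rewrite /test_fun /a /b; ring.
have h3 : test_fun p q a b c 1 t3 = 0.
  have -> : test_fun p q a b c 1 t3 = t3 ^+ q - t1 ^+ q - n * (t3 - t1) +
     c * (`|t3| `^ p - `|t1| `^ p - m * (t3 - t1)).
    by rewrite /test_fun /a /b; ring.
  by rewrite /n /m; field; lra.
have hd (x : R) : is_derive x (1 : R) (test_fun p q a b c 1)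
    (b + c * (p * sgpow (p - 1) x) + q%:R * x ^+ q.-1).
  have H := is_derive_norm_powR x p1.
  have Hq : is_derive x (1 : R) (fun y : R => y ^+ q) (q%:R * x ^+ q.-1).
    have := @is_deriveX _ _ (@idfun R) q x 1 1 (is_derive_id _ _).
    by rewrite exprfctE /GRing.scale/= mulr1.
  rewrite /test_fun; apply: is_derive_eq; rewrite /GRing.scale/=.
  by ring.
exact: (three_zeros hd (valley_derive oq p1 pq) t12 t23 h1 h2 h3).
Qed.

(** The finite exceptional set Z absorbs the points where k or phi changes sign.
    The strict sign of k outside Z is what later turns a vanishing integral of
    k * phi into phi = 0 almost everywhere. *)
Definition opposes (R : realType) (k phi : R -> R) : Prop :=
  exists Z : seq R, forall x, x \notin Z ->
    (0 < k x /\ phi x <= 0) \/ (k x < 0 /\ 0 <= phi x).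

(** The set where phi > 0 to the right of t1 is an interval with endpoints
    alpha = inf S and beta = sup S, so phi has the sign pattern +, -, +, - with
    changes at t1, alpha and beta, some of which may be absent.  In each case
    the test function changes sign where phi does, up to single points:
    - S empty, or alpha = beta: x - t1;
    - beta infinite and alpha = t1: the constant -1;
    - beta infinite and t1 < alpha: the chord of |x|^p minus |x|^p;
    - beta finite and alpha = t1: x - beta;
    - t1 < alpha < beta finite: the test function with zeros t1, alpha, beta. *)
Lemma exists_opposing_test_fun (R : realType) (p : R) (q : nat) (t1 : R)
    (phi : R -> R) :
  odd q -> 1 < p -> p < q%:R ->
  (forall x, x < t1 -> 0 <= phi x) ->
  (forall x y z, t1 <= x -> x < y -> y < z -> 0 < phi x -> 0 < phi z -> 0 < phi y) ->
  exists a b c e, 0 <= e /\ opposes (test_fun p q a b c e) phi.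
Proof.
move=> oq p1 pq phil phic.
pose S : set R := [set x | t1 <= x /\ 0 < phi x].
have Slb : has_lbound S by exists t1 => x [].
have SE x : S x -> t1 <= x /\ 0 < phi x by [].
have nS x : ~ S x -> t1 < x -> phi x <= 0.
  move=> nSx tx; rewrite leNgt; apply/negP => px; apply: nSx; split=> //.
  exact: ltW.
have [[s Ss]|/nonemptyPn S0] := pselect (S !=set0); last first.
  exists (- t1), 1, 0, 0; split => //; exists [:: t1] => x.
  rewrite inE /test_fun => /eqP xt.
  have [xlt|xgt|//] := ltgtP x t1.
  - by right; split; [lra|exact: phil].
  - by left; split; [lra|apply: nS => //; rewrite S0].
have SN0 : S !=set0 by exists s.
have ta : t1 <= inf S by apply: lb_le_inf => // x [].
have lta x : t1 < x -> x < inf S -> phi x <= 0.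
  move=> tx xa; apply: nS => // Sx.
  by have := ge_inf Slb Sx; rewrite leNgt xa.
have [Sub|nSub] := pselect (has_ubound S); last first.
  have gta x : inf S < x -> 0 <= phi x.
    move=> ax; have [u /SE[tu pu] ux] := inf_lt SN0 ax.
    have [v [/SE[tv pv] xv]] : exists v, S v /\ x < v.
      apply: contrapT => nv; apply: nSub; exists x => v Sv.
      by rewrite leNgt; apply/negP => xv; apply: nv; exists v.
    exact/ltW/(phic u x v).
  have [ta1|ta1|ta1] := ltgtP t1 (inf S); last 1 first.
  - exists (-1), 0, 0, 0; split=> //; exists [:: t1] => x.
    rewrite inE /test_fun => /eqP xt; right; split; first by lra.
    have [xlt|xgt|//] := ltgtP x t1; first exact: phil.
    by apply: gta; rewrite -ta1.
  - have [a [b H]] := test_fun_convex q p1 ta1.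
    exists (- a), (- b), (-1), 0; split=> //; exists [:: t1; inf S] => x.
    rewrite !inE negb_or => /andP[/eqP xt /eqP xa].
    have [h1 h2 h3] := H x.
    have -> : test_fun p q (- a) (- b) (-1) 0 x = - test_fun p q a b 1 0 x.
      by rewrite /test_fun; ring.
    have [xlt|xgt|//] := ltgtP x t1.
      by right; split; [have := h1 xlt; lra|exact: phil].
    have [xlt'|xgt'|//] := ltgtP x (inf S).
      left; split; last exact: lta.
      by rewrite xgt xlt' in h2; have := h2 isT; lra.
    by right; split; [have := h3 xgt'; lra|exact: gta].
  - by move: ta; rewrite leNgt ta1.
have gtb x : sup S < x -> phi x <= 0.
  move=> bx; apply: nS; last first.
    have [ts _] := Ss; apply: le_lt_trans bx; apply: le_trans ts _.
    exact: ub_le_sup.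
  by move=> Sx; have := ub_le_sup Sub Sx; rewrite leNgt bx.
have mid x : inf S < x -> x < sup S -> 0 <= phi x.
  move=> ax xb; have [u /SE[tu pu] ux] := inf_lt SN0 ax.
  have [v /SE[tv pv] xv] := sup_gt SN0 xb.
  exact/ltW/(phic u x v).
have ab : inf S <= sup S by apply: (le_trans (ge_inf Slb Ss)); exact: ub_le_sup.
have [ta1|ta1|ta1] := ltgtP t1 (inf S); last 1 first.
- exists (- sup S), 1, 0, 0; split=> //; exists [:: t1; sup S] => x.
  rewrite !inE negb_or /test_fun => /andP[/eqP xt /eqP xb].
  have [xlt|xgt|//] := ltgtP x (sup S).
    right; split; first by lra.
    have [xlt'|xgt'|//] := ltgtP x t1; first exact: phil.
    by apply: mid => //; rewrite -ta1.
  by left; split; [lra|exact: gtb].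
- have [ab1|ab1|ab1] := ltgtP (inf S) (sup S).
  + have [a [b [c H]]] := test_fun_three oq p1 pq ta1 ab1.
    exists a, b, c, 1; split=> //; exists [:: t1; inf S; sup S] => x.
    rewrite !inE !negb_or => /and3P[/eqP xt /eqP xa /eqP xb].
    have [h1 h2 h3 h4] := H x.
    have [x1|x1|//] := ltgtP x t1.
      by right; split; [exact: h1|exact: phil].
    have [x2|x2|//] := ltgtP x (inf S).
      by left; split; [apply: h2; rewrite x1|exact: lta].
    have [x3|x3|//] := ltgtP x (sup S).
      by right; split; [apply: h3; rewrite x2|exact: mid].
    by left; split; [exact: h4|exact: gtb].
  + by move: ab; rewrite leNgt ab1.
  + exists (- t1), 1, 0, 0; split=> //; exists [:: t1; inf S] => x.
    rewrite !inE !negb_or /test_fun => /andP[/eqP xt /eqP xa].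
    have [x1|x1|//] := ltgtP x t1.
      by right; split; [lra|exact: phil].
    left; split; first by lra.
    have [x2|x2|//] := ltgtP x (inf S); first exact: lta.
    by apply: gtb; rewrite -ab1.
- by move: ta; rewrite leNgt ta1.
Qed.

(** * Log-concave functions *)

Lemma conv_lmodE (R : realType) (t : {i01 R}) (x y : R) :
  conv t (x : convex_lmodType R^o) (y : convex_lmodType R^o) =
  t%:num * x + (1 - t%:num) * y.
Proof. by []. Qed.

Lemma convRE1 (R : realType) (t : {i01 R}) (x y : R) :
  conv t (x : R^o) (y : R^o) = t%:num * x + (1 - t%:num) * y.
Proof. by []. Qed.

Lemma log_concave_between (R : realType) (f : R -> R) (x y z : R) :
  log_concave_fun f -> x < y -> y < z -> 0 < f x -> 0 < f z ->
  0 < f y /\ (z - y) * ln (f x) + (y - x) * ln (f z) <= (z - x) * ln (f y).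
Proof.
move=> [cs cf] xy yz fx fz.
pose t := (z - y) / (z - x).
have t0 : 0 <= t by rewrite /t divr_ge0; lra.
have t1 : t <= 1 by rewrite /t ler_pdivrMr; lra.
pose T : {i01 R} := Itv01 t0 t1.
have tE : T%:num * x + (1 - T%:num) * z = y by rewrite /= /t; field; lra.
have fy : 0 < f y.
  have := cs x z T (mem_set fx) (mem_set fz).
  by rewrite inE /= conv_lmodE tE.
split=> //.
have := cf T x z (mem_set fx) (mem_set fz).
rewrite conv_lmodE tE convRE1 /=.
rewrite (_ : 1 - t = (y - x) / (z - x)); last by rewrite /t; field; lra.
have zx : 0 < z - x by lra.
rewrite -(ler_pM2l zx) /t.
rewrite (_ : (z - x) * (_ + _) = - ((z - y) * ln (f x) + (y - x) * ln (f z))).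
  by rewrite mulrN lerN2.
by field; lra.
Qed.

(** On [-1, +oo) the logarithm of the shifted exponential density is affine,
    so f exceeds it exactly where the concave function ln f lies above an
    affine one. *)
Lemma excess_between (R : realType) (f : R -> R) (x y z : R) :
  log_concave_fun f -> -1 <= x -> x < y -> y < z ->
  0 < f x - shifted_exponential_pdf x -> 0 < f z - shifted_exponential_pdf z ->
  0 < f y - shifted_exponential_pdf y.
Proof.
move=> lc x1 xy yz.
rewrite /shifted_exponential_pdf !ifT; [|lra..].
rewrite !subr_gt0 => hx hz.
have fx : 0 < f x := lt_trans (expR_gt0 _) hx.
have fz : 0 < f z := lt_trans (expR_gt0 _) hz.
have [fy H] := log_concave_between lc xy yz fx fz.
rewrite -(lnK fx) ltr_expR in hx; rewrite -(lnK fz) ltr_expR in hz.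
rewrite -(lnK fy) ltr_expR.
have zx : 0 < z - x by lra.
by rewrite -(ltr_pM2l zx); apply: lt_le_trans H; nra.
Qed.

Lemma log_concave_shifted_exponential (R : realType) :
  log_concave_fun (@shifted_exponential_pdf R).
Proof.
have supp (x : R) : 0 < shifted_exponential_pdf x -> -1 <= x.
  by rewrite /shifted_exponential_pdf; case: ifP => //; rewrite ltxx.
have pos (x : R) : -1 <= x -> 0 < shifted_exponential_pdf x.
  by rewrite /shifted_exponential_pdf => ->; exact: expR_gt0.
have cvx (x y : R) (t : {i01 R}) : -1 <= x -> -1 <= y ->
    -1 <= t%:num * x + (1 - t%:num) * y.
  move=> hx hy; have t0 : 0 <= t%:num by exact: ge0.
  have t1 : t%:num <= 1 by exact: le1.
  by move: (t%:num) t0 t1 => s t0 t1; nra.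
have lnE (x : R) : -1 <= x -> ln (shifted_exponential_pdf x) = - (x + 1).
  by rewrite /shifted_exponential_pdf => ->; rewrite expRK.
split=> [x y t|t x y]; rewrite !inE /= conv_lmodE.
  by move=> /supp hx /supp hy; apply: pos; exact: cvx.
move=> /supp hx /supp hy; rewrite convRE1 !lnE//; last exact: cvx.
rewrite le_eqVlt; apply/orP; left; apply/eqP; ring.
Qed.

(** * Expectations as integrals against the density *)

Section density.
Variables (R : realType) (d : measure_display) (T : measurableType d)
  (P : probability T R) (X : {RV P >-> R}) (f : R -> R).
Hypothesis Xf : has_density X f.
Local Notation mu := (@lebesgue_measure R).

(* The Borel sets of R and of [measurableTypeR R], on which Lebesgue measure is
   defined, are the same but carry different displays; X' is X with values in
   the latter, so that its law can be compared with Lebesgue measure. *)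
Let mX : measurable_fun [set: T] (X : T -> measurableTypeR R).
Proof. exact: (@measurable_funPT _ _ _ _ X). Qed.

Let X' : {mfun T >-> measurableTypeR R} :=
  HB.pack (X : T -> measurableTypeR R) (isMeasurableFun.Build _ _ _ _ _ mX).

Let lawE (A : set (measurableTypeR R)) : measurable A ->
  distribution P X' A = (\int[mu]_(x in A) (f x)%:E)%E.
Proof. by have [mf f0 fE] := Xf; exact: fE. Qed.

Let law_null_dominates : distribution P X' `<< mu.
Proof.
have [mf f0 fE] := Xf.
apply/null_content_dominatesP => A mA A0; rewrite lawE//.
apply: null_set_integral => //; apply/measurable_EFinP.
exact: measurable_funTS.
Qed.

(** The density is almost everywhere the Radon-Nikodym derivative of the law,
    for which this change of variables is known. *)
Lemma ge0_integral_density (h : R -> \bar R) :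
  measurable_fun [set: R] h -> (forall x, 0 <= h x)%E ->
  (\int[P]_w h (X w) = \int[mu]_x (h x * (f x)%:E))%E.
Proof.
move=> mh h0; have [mf f0 fE] := Xf.
pose g := Radon_Nikodym_SigmaFinite.f (distribution P X') mu.
have gint : mu.-integrable setT g.
  exact/Radon_Nikodym_SigmaFinite.f_integrable/law_null_dominates.
have mEf : measurable_fun [set: measurableTypeR R] (EFin \o f).
  exact/measurable_EFinP.
have gf : ae_eq mu setT g (EFin \o f).
  apply: integral_ae_eq => // E _ mE.
  rewrite -(Radon_Nikodym_SigmaFinite.f_integral law_null_dominates mE).
  exact: lawE.
transitivity (\int[distribution P X']_x h x)%E.
  by rewrite (ge0_integral_distribution X').
rewrite -(Radon_Nikodym_SigmaFinite.change_of_variables law_null_dominates h0)//.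
apply: ae_eq_integral => //.
- by apply: emeasurable_funM => //; exact: measurable_int gint.
- exact: emeasurable_funM.
- exact: ae_eqe_mul2l.
Qed.

Lemma integrable_density (h : R -> R) : measurable_fun [set: R] h ->
  P.-integrable [set: T] (fun w => (h (X w))%:E) ->
  mu.-integrable [set: R] (fun x => (h x * f x)%:E).
Proof.
move=> mh /integrableP[_ hi]; have [mf f0 fE] := Xf.
apply/integrableP; split.
  by apply/measurable_EFinP; exact: measurable_funM.
have E : (\int[mu]_x `|(h x * f x)%:E| = \int[mu]_x (`|(h x)%:E| * (f x)%:E))%E.
  by apply: eq_integral => x _; rewrite EFinM abseM [X in (_ * X)%E]gee0_abs// lee_fin.
rewrite E -(@ge0_integral_density (fun x => `|(h x)%:E|%E))//.
by apply: measurableT_comp => //; exact/measurable_EFinP.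
Qed.

Lemma integral_density (h : R -> R) : measurable_fun [set: R] h ->
  (\int[P]_w (h (X w))%:E = \int[mu]_x (h x * f x)%:E)%E.
Proof.
move=> mh; have [mf f0 fE] := Xf.
have mh' : measurable_fun [set: R] (EFin \o h) by exact/measurable_EFinP.
rewrite integralE [RHS]integralE.
rewrite (_ : (fun w => (h (X w))%:E)^\+ = (fun w => (EFin \o h)^\+ (X w)))%E; last first.
  by apply/funext => w; rewrite !funeposE.
rewrite (_ : (fun w => (h (X w))%:E)^\- = (fun w => (EFin \o h)^\- (X w)))%E; last first.
  by apply/funext => w; rewrite !funenegE.
rewrite !ge0_integral_density//; first last.
- exact: measurable_funepos.
- exact: measurable_funeneg.
have mulE (a b : R) : 0 <= b -> maxe (a * b)%:E 0%E = (maxe a%:E 0 * b%:E)%E.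
  move=> b0; have [a0|/ltW a0] := leP 0 a.
    by rewrite !max_l ?lee_fin// mulr_ge0.
  by rewrite !max_r ?lee_fin ?mul0e// mulr_le0_ge0.
congr (_ - _)%E; apply: eq_integral => x _.
- by rewrite !funeposE /= mulE.
- by rewrite !funenegE /= -mulNr mulE.
Qed.

End density.

(** * Scaling a random variable *)

Lemma scale_mfunE (R : realType) (d : measure_display) (T : measurableType d)
  (P : probability T R) (X : {RV P >-> R}) (s : R) (w : T) :
  (s *: (X : {mfun T >-> R}) : {RV P >-> R}) w = s * X w.
Proof. by []. Qed.

Lemma scale_fun_measurable (R : realType) (s : R) :
  measurable_fun [set: measurableTypeR R] ( *%R s : _ -> measurableTypeR R).
Proof. exact: mulrl_measurable. Qed.

(** The pushforward of Lebesgue measure under multiplication by s. *)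
Definition lebesgue_scaled (R : realType) (s : R) :
    {measure set (measurableTypeR R) -> \bar R} :=
  measure_function_pushforward__canonical__measure_function_Measure
    (@lebesgue_measure R) (scale_fun_measurable s).

(** Both sides are measures that agree on intervals, which determine a Borel
    measure. *)
Lemma lebesgue_measure_scale (R : realType) (s : R) (A : set (measurableTypeR R)) :
  s != 0 -> measurable A ->
  lebesgue_measure A = mscale (NngNum (normr_ge0 s)) (lebesgue_scaled s) A.
Proof.
move=> s0 mA; apply: lebesgue_measure_unique => // _ [[a b]] _ <-.
transitivity (`|s|%:E * lebesgue_measure ( *%R s @^-1` `]a, b] : set (measurableTypeR R)))%E;
  last by [].
have [sp|sn] : 0 < s \/ s < 0 by move: s0; rewrite neq_lt => /orP[]; tauto.
- rewrite [X in (_ * lebesgue_measure X)%E](_ : _ = `](a / s), (b / s)]%classic); last first.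
    apply/seteqP; split=> x /=; rewrite !in_itv /= => /andP[h1 h2].
      by rewrite ltr_pdivrMr// ler_pdivlMr// mulrC h1 h2.
    by rewrite mulrC -ltr_pdivrMr// -ler_pdivlMr// h1 h2.
  rewrite !lebesgue_measure_itv/= !lte_fin ltr_pM2r ?invr_gt0//.
  case: ifP => ab; last by rewrite mule0.
  by rewrite gtr0_norm// -EFinB -EFinM; congr (_%:E); field; lra.
- rewrite [X in (_ * lebesgue_measure X)%E](_ : _ = `[(b / s), (a / s)[%classic); last first.
    apply/seteqP; split=> x /=; rewrite !in_itv /= => /andP[h1 h2].
      by rewrite ltr_ndivlMr// ler_ndivrMr// mulrC h1 h2.
    by rewrite mulrC -ltr_ndivlMr// -ler_ndivrMr// h1 h2.
  rewrite !lebesgue_measure_itv/= !lte_fin ltr_nM2r ?invr_lt0//.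
  case: ifP => ab; last by rewrite mule0.
  by rewrite ltr0_norm// -EFinB -EFinM; congr (_%:E); field; lra.
Qed.

(** The change of variables y = s x in the integral of f. *)
Lemma has_density_scale (R : realType) (d : measure_display) (T : measurableType d)
  (P : probability T R) (X : {RV P >-> R}) (f : R -> R) (s : R) : s != 0 ->
  has_density X f ->
  has_density (s *: (X : {mfun T >-> R}) : {RV P >-> R})
    (fun y => `|s|^-1 * f (s^-1 * y)).
Proof.
move=> s0 [mf f0 fE].
have ms : measurable_fun [set: R] (fun y : R => s^-1 * y).
  exact: mulrl_measurable.
split.
- apply: measurable_funM => //.
  exact: (measurableT_comp mf ms).
- by move=> x; rewrite mulr_ge0// invr_ge0.
move=> A mA; pose B : set R := *%R s @^-1` A.
have mB : measurable B.
  by rewrite -[B]setTI; have := @mulrl_measurable R setT s; exact.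
have EB : A = *%R s^-1 @^-1` B.
  apply/seteqP; split=> x /=; rewrite /B /= mulrA divff// mul1r//.
transitivity (distribution P X B); first by [].
rewrite fE//.
have mfB : measurable_fun (B : set (measurableTypeR R)) (EFin \o f).
  by apply/measurable_EFinP; exact: measurable_funTS.
have f0' x : B x -> (0 <= (EFin \o f) x)%E by rewrite lee_fin.
pose k : {nonneg R} := NngNum (normr_ge0 s^-1).
transitivity (\int[mscale k (lebesgue_scaled s^-1%R)]_(x in B) (f x)%:E)%E.
  apply: eq_measure_integral => C mC _.
  by apply: lebesgue_measure_scale => //; rewrite invr_eq0.
rewrite ge0_integral_mscale//.
have := @ge0_integral_pushforward _ _ _ _ R _ (scale_fun_measurable s^-1)
  (@lebesgue_measure R) B (EFin \o f) mB mfB.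
move=> -> //; last by move=> x xB; apply: f0'; exact: set_mem.
rewrite -EB -ge0_integralZl//=.
- by apply: eq_integral => x _; rewrite EFinM normfV.
- apply/measurable_EFinP; apply: measurable_funTS.
  exact: (measurableT_comp mf ms).
- by move=> x _; rewrite lee_fin.
Qed.

Lemma log_concave_scale (R : realType) (f : R -> R) (s : R) : s != 0 ->
  log_concave_fun f -> log_concave_fun (fun y => `|s|^-1 * f (s^-1 * y)).
Proof.
move=> s0 [cs cf].
have sp : 0 < `|s|^-1 by rewrite invr_gt0 normr_gt0.
have cE (t : {i01 R}) (x y : R) :
  s^-1 * (conv t (x : convex_lmodType R^o) (y : convex_lmodType R^o)) =
  conv t (s^-1 * x : convex_lmodType R^o) (s^-1 * y : convex_lmodType R^o).
  by rewrite /conv /= /GRing.scale /=; ring.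
split=> [x y t|t x y]; rewrite !inE /= !pmulr_rgt0//.
  move=> fx fy; rewrite cE.
  by have := cs _ _ t (mem_set fx) (mem_set fy); rewrite inE.
move=> fx fy.
have := cs _ _ t (mem_set fx) (mem_set fy); rewrite inE /= => fc.
have := cf t _ _ (mem_set fx) (mem_set fy).
rewrite cE !lnM ?posrE// => H.
by move: H; rewrite !convRE1 => H; lra.
Qed.

(** * Exponential tails and moments of log-concave densities *)

Lemma density_integral1 (R : realType) (d : measure_display) (T : measurableType d)
  (P : probability T R) (X : {RV P >-> R}) (f : R -> R) :
  has_density X f -> (\int[lebesgue_measure]_x (f x)%:E = 1)%E.
Proof.
move=> [mf f0 fE]; rewrite -fE//; exact: probability_setT.
Qed.

Lemma density_pos_point (R : realType) (d : measure_display) (T : measurableType d)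
  (P : probability T R) (X : {RV P >-> R}) (f : R -> R) :
  has_density X f -> exists a, 0 < f a.
Proof.
move=> Xf; apply: contrapT => nf.
have := density_integral1 Xf.
rewrite integral0_eq; first by move=> /eqP; rewrite eqe eq_sym oner_eq0.
move=> x _; congr (_%:E); have [_ f0 _] := Xf.
apply/eqP; rewrite eq_le f0 andbT leNgt; apply/negP => fx.
by apply: nf; exists x.
Qed.

(** Otherwise f >= f a on all of (a, +oo), and f would not be integrable.  The
    interval (a, a + 2 / f a] already gives f an integral of at least 2. *)
Lemma density_decreases (R : realType) (d : measure_display) (T : measurableType d)
  (P : probability T R) (X : {RV P >-> R}) (f : R -> R) (a : R) :
  has_density X f -> 0 < f a -> exists2 b, a < b & f b < f a.
Proof.
move=> Xf fa; have [mf f0 fE] := Xf.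
apply: contrapT => nb.
have fge x : a < x -> f a <= f x.
  by move=> ax; rewrite leNgt; apply/negP => fx; apply: nb; exists x.
pose c := a + 2 / f a.
have ac : a < c by rewrite ltrDl divr_gt0.
have mE : measurable_fun [set: measurableTypeR R] (EFin \o f) by exact/measurable_EFinP.
have : (\int[lebesgue_measure]_(x in `]a, c]) (f a)%:E <= 1)%E.
  rewrite -(density_integral1 Xf).
  apply: (@le_trans _ _ (\int[lebesgue_measure]_(x in `]a, c]) (f x)%:E)%E).
    apply: ge0_le_integral => //.
    - by move=> x _; rewrite lee_fin ltW.
    - exact: measurable_funTS.
    - by move=> x /=; rewrite in_itv/= => /andP[ax _]; rewrite lee_fin fge.
  by apply: ge0_subset_integral => // x _; rewrite lee_fin.
rewrite integral_cst// [X in (_ * X)%E]lebesgue_measure_itv/= lte_fin ac -EFinB -EFinM lee_fin.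
rewrite /c (_ : f a * _ = 2); last by field; lra.
by lra.
Qed.

(** If f b < f a with a < b, then to the right of b the concave function ln f
    lies below the line through its values at a and b, whose slope -e is
    negative; if f b = 0, then f vanishes to the right of b. *)
Lemma log_concave_tail (R : realType) (d : measure_display) (T : measurableType d)
  (P : probability T R) (X : {RV P >-> R}) (f : R -> R) :
  has_density X f -> log_concave_fun f ->
  exists b C e, [/\ 0 <= b, 0 < C, 0 < e & forall x, b < x -> f x <= C * expR (- e * x)].
Proof.
move=> Xf lc; have [_ f0 _] := Xf.
have [a fa] := density_pos_point Xf.
have [b ab fb] := density_decreases Xf fa.
have bmax x : Num.max b 0 < x -> b < x by rewrite gt_max => /andP[].
have [fb0|fb0] := ltP 0 (f b); last first.
  exists (Num.max b 0), 1, 1; split=> //; first by rewrite le_max lexx orbT.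
  move=> x /bmax bx; apply: (@le_trans _ _ 0); last by rewrite mul1r expR_ge0.
  rewrite leNgt; apply/negP => fx.
  by have [] := log_concave_between lc ab bx fa fx; rewrite ltNge fb0.
pose e := (ln (f a) - ln (f b)) / (b - a).
have e0 : 0 < e.
  rewrite /e divr_gt0 ?subr_gt0// ltr_ln// posrE//.
exists (Num.max b 0), (expR (ln (f a) + e * a)), e; split=> //.
- by rewrite le_max lexx orbT.
- exact: expR_gt0.
move=> x /bmax bx; rewrite -expRD.
have [fx|fx] := ltP 0 (f x); last by apply: (le_trans fx); exact: expR_ge0.
rewrite -(lnK fx) ler_expR.
have [_ H] := log_concave_between lc ab bx fa fx.
have ba : 0 < b - a by lra.
rewrite -(ler_pM2l ba) /e.
rewrite [leRHS](_ : _ = (x - a) * ln (f b) - (x - b) * ln (f a)); first by lra.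
by field; lra.
Qed.

Lemma exprn_le_expR (R : realType) (n : nat) (x : R) : 0 <= x ->
  x ^+ n <= n`!%:R * expR x.
Proof.
move=> x0; case: n => [|n].
  by rewrite expr0 mul1r; apply: (le_trans _ (expR_ge1Dx x)); lra.
have := expR_ge1Dxn n x0; have : (0 : R) < n.+1`!%:R by rewrite ltr0n fact_gt0.
move: (n.+1`!%:R : R) => c c0 H.
rewrite mulrC -ler_pdivrMr//; lra.
Qed.

(** Up to b the integrand is at most b^n f.  Beyond b it is at most a multiple
    of x^n exp(-2 dl x), where 2 dl is the decay rate of f, hence at most a
    multiple of the exponential density of rate dl: half of the decay is spent
    on absorbing x^n. *)
Lemma log_concave_pos_moment (R : realType) (d : measure_display) (T : measurableType d)
  (P : probability T R) (X : {RV P >-> R}) (f : R -> R) (n : nat) :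
  has_density X f -> log_concave_fun f ->
  (\int[P]_w ((Num.max (X w) 0) ^+ n)%:E < +oo)%E.
Proof.
move=> Xf lc; have [mf f0 _] := Xf.
have [b [C [e [b0 C0 e0 tail]]]] := log_concave_tail Xf lc.
pose dl := e / 2.
have dl0 : 0 < dl by rewrite divr_gt0.
have eE : e = dl + dl by rewrite /dl; field.
clearbody dl.
pose K := C * n`!%:R / dl ^+ n / dl.
have K0 : 0 <= K.
  by rewrite /K !divr_ge0 ?mulr_ge0 ?ler0n ?exprn_ge0// ltW.
have mm : measurable_fun [set: R] (fun x : R => (Num.max x 0) ^+ n).
  by apply: measurable_funX; exact: measurable_maxr.
rewrite (ge0_integral_density Xf (h := fun x => ((Num.max x 0) ^+ n)%:E)); last 2 first.
- exact/measurable_EFinP.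
- by move=> x; rewrite lee_fin exprn_ge0// le_max lexx orbT.
apply: (@le_lt_trans _ _ (\int[lebesgue_measure]_x
    ((b ^+ n)%:E * (f x)%:E + K%:E * (exponential_pdf dl x)%:E))%E).
  apply: ge0_le_integral => //.
  - by move=> x _; rewrite -EFinM lee_fin mulr_ge0// exprn_ge0// le_max lexx orbT.
  - by apply: emeasurable_funM; apply/measurable_EFinP.
  - apply: emeasurable_funD; apply: emeasurable_funM => //; apply/measurable_EFinP => //.
    exact: measurable_exponential_pdf.
  move=> x _; rewrite -!EFinM -EFinD lee_fin.
  have [xb|bx] := leP x b.
    apply: (@le_trans _ _ (b ^+ n * f x)).
      apply: ler_wpM2r => //; apply: lerXn2r; rewrite ?nnegrE//.
        by rewrite le_max lexx orbT.
      by rewrite ge_max xb b0.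
    by rewrite lerDl mulr_ge0//; exact: exponential_pdf_ge0 (ltW dl0) _.
  have x0 : 0 < x by lra.
  rewrite max_l ?(ltW x0)//.
  apply: (@le_trans _ _ (K * exponential_pdf dl x)); last first.
    by rewrite lerDr mulr_ge0// exprn_ge0.
  rewrite exponential_pdfE ?(ltW x0)//.
  apply: (@le_trans _ _ (x ^+ n * (C * expR (- e * x)))).
    by apply: ler_wpM2l; [rewrite exprn_ge0// ltW|exact: tail].
  have H : (dl * x) ^+ n <= n`!%:R * expR (dl * x).
    by apply: exprn_le_expR; rewrite mulr_ge0// ltW.
  have -> : - e * x = - dl * x + - (dl * x) by rewrite eE; ring.
  rewrite expRD expRN.
  have E0 := expR_gt0 (dl * x).
  have D0 : 0 < dl ^+ n by rewrite exprn_gt0.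
  rewrite (_ : x ^+ n * _ =
    (C * expR (- dl * x) / dl ^+ n / expR (dl * x)) * ((dl * x) ^+ n)); last first.
    by rewrite [(dl * x) ^+ n]exprMn; field; rewrite !gt_eqF.
  rewrite (_ : K * _ =
    (C * expR (- dl * x) / dl ^+ n / expR (dl * x)) *
    (n`!%:R * expR (dl * x))); last first.
    by rewrite /K; field; rewrite !gt_eqF.
  apply: ler_wpM2l => //.
  by rewrite !divr_ge0 ?mulr_ge0 ?expR_ge0// ltW.
rewrite ge0_integralD//; last 4 first.
- by move=> x _; rewrite -EFinM lee_fin mulr_ge0// exprn_ge0.
- by apply: emeasurable_funM => //; apply/measurable_EFinP.
- by move=> x _; rewrite -EFinM lee_fin mulr_ge0//; exact: exponential_pdf_ge0 (ltW dl0) _.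
- by apply: emeasurable_funM => //; apply/measurable_EFinP; exact: measurable_exponential_pdf.
rewrite !ge0_integralZl//; last 5 first.
- by apply/measurable_EFinP; exact: measurable_exponential_pdf.
- by move=> x _; rewrite lee_fin; exact: exponential_pdf_ge0 (ltW dl0) _.
- exact/measurable_EFinP.
- by move=> x _; rewrite lee_fin.
- by rewrite lee_fin exprn_ge0.
by rewrite (density_integral1 Xf) (integral_exponential_pdf dl0) !mule1 -EFinD ltry.
Qed.

(** The negative part of X is the positive part of -X, which is log-concave
    too. *)
Lemma log_concave_moment (R : realType) (d : measure_display) (T : measurableType d)
  (P : probability T R) (X : {RV P >-> R}) (f : R -> R) (n : nat) :
  has_density X f -> log_concave_fun f ->
  P.-integrable [set: T] (fun w => (`|X w| ^+ n)%:E).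
Proof.
move=> Xf lc.
have m1 : (-1 : R) != 0 by rewrite oppr_eq0 oner_eq0.
have Hp := log_concave_pos_moment n Xf lc.
have Hn := log_concave_pos_moment n (has_density_scale m1 Xf) (log_concave_scale m1 lc).
have mX : measurable_fun [set: T] X by exact: measurable_funPT.
apply/integrableP; split.
  by apply/measurable_EFinP; apply: measurable_funX; exact: measurableT_comp.
pose Y : {RV P >-> R} := (-1) *: (X : {mfun T >-> R}).
have pw (Z : {RV P >-> R}) : measurable_fun [set: T] (fun w => ((Num.max (Z w) 0) ^+ n)%:E).
  apply/measurable_EFinP; apply: measurable_funX.
  by apply: measurable_maxr => //; exact: measurable_funPT.
have p0 (Z : {RV P >-> R}) w : [set: T] w -> (0 <= ((Num.max (Z w) 0) ^+ n)%:E)%E.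
  by move=> _; rewrite lee_fin exprn_ge0// le_max lexx orbT.
apply: (@le_lt_trans _ _ (\int[P]_w (((Num.max (X w) 0) ^+ n)%:E +
   ((Num.max (Y w) 0) ^+ n)%:E))%E).
  apply: ge0_le_integral => //.
  - apply: measurableT_comp => //; apply/measurable_EFinP.
    by apply: measurable_funX; exact: measurableT_comp.
  - exact: emeasurable_funD.
  move=> w _; rewrite gee0_abs ?lee_fin ?exprn_ge0//.
  have -> : Y w = - X w by rewrite /Y scale_mfunE mulN1r.
  have [x0|/ltW x0] := leP 0 (X w).
    rewrite ger0_norm// lerDl exprn_ge0//.
    by rewrite le_max lexx orbT.
  rewrite ler0_norm// (max_l (_ : 0 <= - X w)) ?oppr_ge0// lerDr.
  by rewrite exprn_ge0.
rewrite ge0_integralD//; try by [exact: p0|exact: pw].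
exact: lte_add_pinfty.
Qed.

(** * The shifted exponential law is centered *)

(** The shift by 1 makes the integrand nonnegative, with antiderivative
    -(x + 2) exp(-(x + 1)). *)
Lemma shifted_exponential_mean_integral (R : realType) :
  (\int[lebesgue_measure]_x ((x + 1) * @shifted_exponential_pdf R x)%:E = 1)%E.
Proof.
pose F (x : R) := - ((x + 2) * expR (- (x + 1))).
pose g (x : R) := (x + 1) * expR (- (x + 1)).
have dF (x : R) : is_derive x (1 : R) F (g x).
  rewrite /F; apply: is_derive_eq; rewrite /GRing.scale/= /g; ring.
have cg : continuous g.
  have dg (x : R) : is_derive x (1 : R) g (- x * expR (- (x + 1))).
    rewrite /g; apply: is_derive_eq; rewrite /GRing.scale/=; ring.
  move=> x; apply: differentiable_continuous; apply/derivable1_diffP.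
  by case: (dg x).
have cF : continuous F.
  move=> x; apply: differentiable_continuous; apply/derivable1_diffP.
  by case: (dF x).
transitivity (\int[lebesgue_measure]_(x in `[(-1)%R, +oo[) (g x)%:E)%E.
  rewrite [RHS]integral_mkcond; apply: eq_integral => x _.
  rewrite patchE /= /shifted_exponential_pdf.
  case: ifPn => x1; first by rewrite mem_set//= in_itv/= x1.
  by rewrite memNset ?mulr0//= in_itv/= andbT; exact/negP.
rewrite (@ge0_continuous_FTC2y _ g F (-1) 0).
- rewrite /F /= -EFinB; congr (_%:E).
  by rewrite addNr oppr0 expR0; lra.
- by move=> x x1; rewrite /g mulr_ge0 ?expR_ge0//; lra.
- exact: continuous_subspaceT.
(* with y = x + 1 >= 1, y^2 <= 2 exp y gives (y + 1) exp(-y) <= 4 / y *)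
- apply/cvgrPdist_lt => e e0; near=> x.
  have x1 : 1 <= x + 1.
    by rewrite lerDr; near: x; apply: nbhs_pinfty_ge; exact: num_real.
  have x2 : 4 / e < x + 1.
    suff : 4 / e < x by lra.
    by near: x; apply: nbhs_pinfty_gt; exact: num_real.
  have x3 : 4 < e * (x + 1) by rewrite mulrC -ltr_pdivrMr.
  rewrite sub0r normrN /F normrN ger0_norm ?mulr_ge0 ?expR_ge0//; last by lra.
  have y0 : 0 <= x + 1 by lra.
  have := exprn_le_expR 2 y0; rewrite expRN ltr_pdivrMr ?expR_gt0//.
  rewrite /factorial /=; nra.
- by move=> x _; case: (dF x).
- by apply: cvg_at_right_filter; exact: cF.
- by move=> x _; rewrite derive1E; case: (dF x).
Unshelve. all: by end_near. Qed.

Lemma shifted_exponential_mean (R : realType) (d : measure_display)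
  (T : measurableType d) (P : probability T R) (X : {RV P >-> R}) :
  has_density X (@shifted_exponential_pdf R) -> centered X.
Proof.
move=> Xf; rewrite /centered expectation_def.
have := shifted_exponential_mean_integral R.
rewrite -(integral_density Xf (h := fun x => x + 1)); last first.
  exact: measurable_funD.
have iX : P.-integrable [set: T] (fun w => (X w)%:E).
  have H := log_concave_moment 1 Xf (log_concave_shifted_exponential R).
  apply: (le_integrable measurableT _ _ H) => //.
    by apply/measurable_EFinP; exact: measurable_funPT.
  by move=> w _; rewrite /= expr1 normr_id.
have i1 : P.-integrable [set: T] (fun w => (1 : R)%:E).
  exact: finite_measure_integrable_cst.
under eq_integral do rewrite EFinD.
have c1 : (\int[P]_w (1 : R)%:E = 1)%E.
  by rewrite integral_cst// mul1e; exact: probability_setT.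
rewrite integralD// c1 => H.
have : ((\int[P]_w (X w)%:E + 1) - 1 = 1 - 1 :> \bar R)%E by rewrite H.
by rewrite addeK// subee.
Qed.

(** * Moments entering the comparison *)

Lemma ae_imply2 (d : measure_display) (T : measurableType d) (R : realType)
    (mu : {measure set T -> \bar R}) (A B C : T -> Prop) :
  (forall x, A x -> B x -> C x) ->
  {ae mu, forall x, A x} -> {ae mu, forall x, B x} -> {ae mu, forall x, C x}.
Proof. by move=> ABC; apply: filterS2. Qed.

Lemma measurable_norm_powR (R : realType) (p : R) :
  measurable_fun [set: R] (fun x : R => `|x| `^ p).
Proof. exact: (measurableT_comp (f := fun x : R => x `^ p)). Qed.

Section moments.
Variables (R : realType) (d : measure_display) (T : measurableType d)
  (P : probability T R) (X : {RV P >-> R}) (f : R -> R).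
Hypotheses (Xf : has_density X f) (lc : log_concave_fun f).

Let mX : measurable_fun [set: T] X.
Proof. exact: measurable_funPT. Qed.

Lemma integrable_exprn (n : nat) : P.-integrable [set: T] (fun w => (X w ^+ n)%:E).
Proof.
apply: (le_integrable measurableT _ _ (log_concave_moment n Xf lc)) => //.
  by apply/measurable_EFinP; exact: measurable_funX.
by move=> w _; rewrite /= !normrX normr_id.
Qed.

Lemma integrable_norm_powR (p : R) :
  0 <= p -> P.-integrable [set: T] (fun w => (`|X w| `^ p)%:E).
Proof.
move=> p0; have [n pn] : exists n : nat, p <= n%:R.
  by exists (Num.truncn p).+1; rewrite ltW// truncnS_gt.
have H : P.-integrable [set: T] (fun w => (1 + `|X w| ^+ n)%:E).
  under eq_fun do rewrite EFinD.
  apply: integrableD => //; last exact: log_concave_moment Xf lc.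
  exact: finite_measure_integrable_cst.
apply: (le_integrable measurableT _ _ H) => //.
  apply/measurable_EFinP; exact: (measurableT_comp (measurable_norm_powR p)).
move=> w _; rewrite /= lee_fin [leRHS]ger0_norm ?addr_ge0 ?exprn_ge0//.
rewrite ger0_norm ?powR_ge0//.
have [x1|x1] := leP `|X w| 1.
  apply: (@le_trans _ _ 1); last by rewrite lerDl exprn_ge0.
  have -> : 1 = (1 : R) `^ p by rewrite powR1.
  by apply: ge0_ler_powR; rewrite ?nnegrE.
apply: (@le_trans _ _ (`|X w| `^ n%:R)).
  by apply: ler_powR => //; exact: ltW.
by rewrite powR_mulrn// lerDr.
Qed.

Lemma integral_test_fun (p : R) (q : nat) (a b c e : R) : 0 <= p ->
  P.-integrable [set: T] (fun w => (test_fun p q a b c e (X w))%:E) /\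
  (\int[P]_w (test_fun p q a b c e (X w))%:E =
   a%:E + b%:E * \int[P]_w (X w)%:E + c%:E * \int[P]_w (`|X w| `^ p)%:E
   + e%:E * \int[P]_w (X w ^+ q)%:E)%E.
Proof.
move=> p0.
have i0 : P.-integrable [set: T] (fun w => a%:E) by exact: finite_measure_integrable_cst.
have i1 : P.-integrable [set: T] (fun w => (X w)%:E) := integrable_exprn 1.
have ip := integrable_norm_powR p0.
have iq := integrable_exprn q.
have E : (fun w => (test_fun p q a b c e (X w))%:E) =
  (fun w => (a%:E + b%:E * (X w)%:E + c%:E * (`|X w| `^ p)%:E + e%:E * (X w ^+ q)%:E)%E).
  by apply/funext => w; rewrite /test_fun !EFinD !EFinM.
have j1 := integrableZl measurableT b i1.
have jp := integrableZl measurableT c ip.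
have jq := integrableZl measurableT e iq.
have k1 := integrableD measurableT i0 j1.
have k2 := integrableD measurableT k1 jp.
have k3 := integrableD measurableT k2 jq.
rewrite E; split; first exact: k3.
rewrite (integralD measurableT k2 jq) (integralD measurableT k1 jp) (integralD measurableT i0 j1).
rewrite !integralZl//.
congr (_ + _ + _ + _)%E.
by rewrite integral_cst// [X in (_ * X)%E]probability_setT mule1.
Qed.

(** A random variable with a density is not almost surely 0. *)
Lemma norm_powR_moment_gt0 (p : R) : 0 < p -> (0 < \int[P]_w (`|X w| `^ p)%:E)%E.
Proof.
move=> p0; have [mf f0 _] := Xf.
rewrite lt_neqAle integral_ge0 ?andbT; last by move=> w _; rewrite lee_fin powR_ge0.
apply/eqP => /esym; rewrite (ge0_integral_density Xf (h := fun x => (`|x| `^ p)%:E)); last 2 first.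
- by apply/measurable_EFinP; exact: measurable_norm_powR.
- by move=> x; rewrite lee_fin powR_ge0.
move=> H.
have mpf : measurable_fun [set: measurableTypeR R] (fun x : R => ((`|x| `^ p)%:E * (f x)%:E)%E).
  by apply: emeasurable_funM; apply/measurable_EFinP => //; exact: measurable_norm_powR.
have ae0 : ae_eq lebesgue_measure setT (fun x : R => ((`|x| `^ p)%:E * (f x)%:E)%E) (cst 0%E).
  apply/ae_eq_integral_abs => //; rewrite -[RHS]H; apply: eq_integral => x _.
  by rewrite gee0_abs// -EFinM lee_fin mulr_ge0 ?powR_ge0.
have : ae_eq lebesgue_measure setT (EFin \o f) (cst 0%E).
  have n0 : {ae @lebesgue_measure R, forall x, x != 0}.
    exists [set 0]; split => //; first exact: lebesgue_measure_set1.
    by move=> x /= /negP; rewrite negbK => /eqP.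
  apply: ae_imply2 n0 ae0 => x x0 /(_ I) /= + _.
  rewrite -EFinM => /eqP; rewrite eqe mulf_eq0 powR_eq0 normr_eq0 (negbTE x0) /=.
  by move=> /eqP ->.
move=> f0ae.
have : (\int[lebesgue_measure]_x (f x)%:E = \int[lebesgue_measure]_(x in setT) cst 0 x :> \bar R)%E.
  by apply: ae_eq_integral f0ae => //; exact/measurable_EFinP.
by rewrite integral0 (density_integral1 Xf) => /eqP; rewrite eqe oner_eq0.
Qed.

End moments.

(** * The crossing argument *)

Lemma measurable_test_fun (R : realType) (p : R) (q : nat) (a b c e : R) :
  measurable_fun [set: R] (test_fun p q a b c e).
Proof.
apply: measurable_funD; last by apply: measurable_funM => //; exact: measurable_funX.
apply: measurable_funD; last first.
  by apply: measurable_funM => //; exact: measurable_norm_powR.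
by apply: measurable_funD => //; exact: measurable_funM.
Qed.

Lemma ae_notin_seq (R : realType) (Z : seq R) :
  {ae @lebesgue_measure R, forall x, x \notin Z}.
Proof.
exists [set` Z]; split.
- by apply: countable_measurable => //; apply: finite_set_countable; exact: finite_seq.
- by apply: countable_lebesgue_measure0; apply: finite_set_countable; exact: finite_seq.
- by move=> x /= /negP; rewrite negbK.
Qed.

Section opposing.
Variables (R : realType) (d d' : measure_display)
  (T : measurableType d) (T' : measurableType d')
  (P : probability T R) (P' : probability T' R)
  (X : {RV P >-> R}) (Y : {RV P' >-> R}) (f g k : R -> R).
Hypotheses (Xf : has_density X f) (Yg : has_density Y g).
Local Notation mu := (@lebesgue_measure R).

Lemma eq_density_ae : {ae mu, forall x, f x = g x} -> same_law X Y.
Proof.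
move=> fg A mA; have [mf _ fE] := Xf; have [mg _ gE] := Yg.
rewrite fE// gE//.
apply: ae_eq_integral => //.
- by apply/measurable_EFinP; exact: measurable_funTS.
- by apply/measurable_EFinP; exact: measurable_funTS.
- by apply: (ae_imply2 _ fg fg) => x /= -> _ _.
Qed.

(** The function k (g - f) is almost everywhere nonnegative, and its integral is
    at most 0 by assumption, so it vanishes almost everywhere; as k has only
    finitely many zeros, f = g almost everywhere. *)
Lemma opposes_same_law :
  measurable_fun [set: R] k -> opposes k (fun x => f x - g x) ->
  P.-integrable [set: T] (fun w => (k (X w))%:E) ->
  P'.-integrable [set: T'] (fun w => (k (Y w))%:E) ->
  (\int[P']_w (k (Y w))%:E <= \int[P]_w (k (X w))%:E)%E -> same_law X Y.
Proof.
move=> mk [Z kZ] iX iY; have [mf f0 _] := Xf; have [mg g0 _] := Yg.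
rewrite (integral_density Xf mk) (integral_density Yg mk).
have jX := integrable_density Xf mk iX.
have jY := integrable_density Yg mk iY.
move=> le; apply: eq_density_ae.
pose u (x : R) : \bar R := ((k x * g x)%:E - (k x * f x)%:E)%E.
have uE x : u x = (k x * (g x - f x))%:E by rewrite /u -EFinB mulrBr.
have iu : mu.-integrable setT u := integrableB measurableT jY jX.
have mu_ : measurable_fun [set: measurableTypeR R] u := measurable_int _ iu.
have uI : (\int[mu]_x u x <= 0)%E.
  rewrite (integralB measurableT jY jX) sube_le0//.
have uZ x : x \notin Z -> (0 <= u x)%E.
  move=> xZ; rewrite uE lee_fin.
  have [[k0 fg]|[k0 fg]] := kZ x xZ.
    by apply: mulr_ge0; lra.
  by apply: mulr_le0; lra.
have absu : ae_eq mu setT (fun x => `|u x|%E) u.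
  have Zae := ae_notin_seq Z.
  by apply: (ae_imply2 _ Zae Zae) => x xZ _ _; rewrite gee0_abs// uZ.
have u0 : (\int[mu]_x `|u x| = 0)%E.
  apply/eqP; rewrite eq_le integral_ge0 ?andbT//.
  apply: le_trans uI; rewrite le_eqVlt; apply/orP; left; apply/eqP.
  by apply: ae_eq_integral absu => //; exact: measurableT_comp.
have ae0 : ae_eq mu setT u (cst 0%E) by apply/ae_eq_integral_abs.
apply: (ae_imply2 _ (ae_notin_seq Z) ae0) => x xZ /(_ I) /=.
rewrite uE => /eqP; rewrite eqe mulf_eq0 subr_eq0 => /orP[/eqP k0|/eqP//].
by have := kZ x xZ; rewrite k0 ltxx => -[[]|[]].
Qed.

End opposing.

(** The normalised form of the theorem, inequality and equality case at once:
    under equal p-th absolute moments, the q-th moment of X can only reach that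
    of the shifted exponential if the laws coincide. *)
Lemma shifted_exponential_extremal (R : realType) (d d' : measure_display)
  (T : measurableType d) (T' : measurableType d')
  (P : probability T R) (P' : probability T' R)
  (X : {RV P >-> R}) (G : {RV P' >-> R}) (f : R -> R) (q : nat) (p : R) :
  has_density X f -> log_concave_fun f -> centered X ->
  has_density G (@shifted_exponential_pdf R) ->
  odd q -> 1 < p -> p < q%:R ->
  (\int[P]_w (`|X w| `^ p)%:E = \int[P']_w (`|G w| `^ p)%:E)%E ->
  (\int[P']_w (G w ^+ q)%:E <= \int[P]_w (X w ^+ q)%:E)%E ->
  same_law X G.
Proof.
move=> Xf lc cX Gg oq p1 pq pE qle.
have cG := shifted_exponential_mean Gg.
have lg := log_concave_shifted_exponential R.
have p0 : 0 <= p by lra.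
have [a [b [c [e [e0 opp]]]]] :
    exists a b c e, 0 <= e /\ opposes (test_fun p q a b c e)
      (fun x => f x - shifted_exponential_pdf x).
  apply: (@exists_opposing_test_fun _ p q (-1)) => //.
    move=> x x1; rewrite /shifted_exponential_pdf ifF ?subr0; last first.
      by apply/negbTE; rewrite -ltNge.
    by have [_ + _] := Xf; exact.
  by move=> x y z x1 xy yz; exact: excess_between lc x1 xy yz.
have [iX EX] := integral_test_fun Xf lc q a b c e p0.
have [iG EG] := integral_test_fun Gg lg q a b c e p0.
apply: (opposes_same_law Xf Gg _ opp iX iG); first exact: measurable_test_fun.
move: cX cG; rewrite /centered !expectation_def => cX cG.
rewrite EX EG cX cG pE leeD2l//.
exact: lee_wpmul2l.
Qed.

(** * The moment ratio *)

Section moment_ratio.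
Variables (R : realType) (d : measure_display) (T : measurableType d)
  (P : probability T R).
Implicit Type X : {RV P >-> R}.

Lemma moment_ratioE X (q : nat) (p m n : R) : 0 < n ->
  (\int[P]_w (X w ^+ q)%:E = m%:E)%E ->
  (\int[P]_w (`|X w| `^ p)%:E = n%:E)%E ->
  moment_ratio X q p = (`|m| `^ q%:R^-1 / n `^ p^-1)%:E.
Proof.
move=> n0 mE nE; rewrite /moment_ratio expectation.unlock Lnorm.unlock /= mE.
rewrite nE abse_EFin !poweR_EFin inver gt_eqF ?powR_gt0//.
Qed.

Lemma moments_finite X (f : R -> R) (q : nat) (p : R) :
  has_density X f -> log_concave_fun f -> 0 < p ->
  exists m n : R, [/\ 0 < n, (\int[P]_w (X w ^+ q)%:E = m%:E)%E &
    (\int[P]_w (`|X w| `^ p)%:E = n%:E)%E].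
Proof.
move=> Xf lc p0.
have fm := integrable_fin_num measurableT (integrable_exprn Xf lc q).
have fn := integrable_fin_num measurableT (integrable_norm_powR Xf lc (ltW p0)).
exists (fine (\int[P]_w (X w ^+ q)%:E)), (fine (\int[P]_w (`|X w| `^ p)%:E)).
split; rewrite ?fineK//.
rewrite fine_gt0// (norm_powR_moment_gt0 Xf p0) -ge0_fin_numE//.
by apply: integral_ge0 => w _; rewrite lee_fin powR_ge0.
Qed.

Lemma integral_exprn_scale X (f : R -> R) (q : nat) (s : R) :
  has_density X f -> log_concave_fun f ->
  (\int[P]_w (((s *: (X : {mfun T >-> R}) : {RV P >-> R}) w) ^+ q)%:E =
   (s ^+ q)%:E * \int[P]_w (X w ^+ q)%:E)%E.
Proof.
move=> Xf lc; rewrite -integralZl//; last exact: integrable_exprn Xf lc q.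
by apply: eq_integral => w _; rewrite scale_mfunE exprMn EFinM.
Qed.

Lemma integral_norm_powR_scale X (p s : R) :
  (\int[P]_w (`|(s *: (X : {mfun T >-> R}) : {RV P >-> R}) w| `^ p)%:E =
   (`|s| `^ p)%:E * \int[P]_w (`|X w| `^ p)%:E)%E.
Proof.
rewrite -ge0_integralZl//.
- by apply: eq_integral => w _; rewrite scale_mfunE normrM powRM// EFinM.
- apply/measurable_EFinP; apply: (measurableT_comp (measurable_norm_powR p)).
  exact: measurable_funPT.
Qed.

Lemma moment_ratio_scale X (f : R -> R) (q : nat) (p s : R) :
  has_density X f -> log_concave_fun f -> (0 < q)%N -> 0 < p -> s != 0 ->
  moment_ratio (s *: (X : {mfun T >-> R}) : {RV P >-> R}) q p = moment_ratio X q p.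
Proof.
move=> Xf lc q0 p0 s0.
have [m [n [n0 mE nE]]] := moments_finite q Xf lc p0.
have sp : 0 < `|s| by rewrite normr_gt0.
have spp : 0 < `|s| `^ p * n by rewrite mulr_gt0// powR_gt0.
rewrite (moment_ratioE n0 mE nE) (@moment_ratioE _ _ _ (s ^+ q * m) (`|s| `^ p * n))//.
- congr (_%:E); rewrite normrM normrX -powR_mulrn// !powRM ?powR_ge0 ?(ltW n0)//.
  rewrite -!powRrM !mulfV ?pnatr_eq0 -?lt0n ?(gt_eqF p0)// !powRr1 ?(ltW sp)//.
  by rewrite -mulf_div divff ?mul1r// gt_eqF.
- by rewrite (integral_exprn_scale _ _ Xf lc) mE.
- by rewrite integral_norm_powR_scale nE.
Qed.

End moment_ratio.

Lemma moment_ratio_density (R : realType) (d d' : measure_display)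
  (T : measurableType d) (T' : measurableType d')
  (P : probability T R) (P' : probability T' R)
  (X : {RV P >-> R}) (Y : {RV P' >-> R}) (f : R -> R) (q : nat) (p : R) :
  has_density X f -> has_density Y f -> moment_ratio X q p = moment_ratio Y q p.
Proof.
move=> Xf Yf; rewrite /moment_ratio expectation.unlock Lnorm.unlock /=.
rewrite (integral_density Xf (h := fun x => `|x| `^ p)); last exact: measurable_norm_powR.
rewrite (integral_density Yf (h := fun x => `|x| `^ p)); last exact: measurable_norm_powR.
rewrite (integral_density Xf (h := fun x => x ^+ q)); last exact: measurable_funX.
by rewrite (integral_density Yf (h := fun x => x ^+ q)); last exact: measurable_funX.
Qed.

Lemma same_law_density (R : realType) (d d' : measure_display)
  (T : measurableType d) (T' : measurableType d')
  (P : probability T R) (P' : probability T' R)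
  (X : {RV P >-> R}) (Y : {RV P' >-> R}) (f : R -> R) :
  same_law X Y -> has_density Y f -> has_density X f.
Proof. by move=> XY [mf f0 fE]; split=> // A mA; rewrite XY// fE. Qed.

Lemma same_law_scale_inv (R : realType) (d d' : measure_display)
  (T : measurableType d) (T' : measurableType d')
  (P : probability T R) (P' : probability T' R)
  (X : {RV P >-> R}) (Y : {RV P' >-> R}) (s : R) : s != 0 ->
  same_law (s *: (X : {mfun T >-> R}) : {RV P >-> R}) Y ->
  same_law X (s^-1 *: (Y : {mfun T' >-> R}) : {RV P' >-> R}).
Proof.
move=> s0 XY A mA.
have mB : measurable ( *%R s^-1 @^-1` A : set R).
  by rewrite -[X in measurable X]setTI; have := @mulrl_measurable R setT s^-1; exact.
have := XY _ mB; rewrite /distribution /pushforward => E.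
transitivity (P ((s *: (X : {mfun T >-> R}) : {RV P >-> R}) @^-1` ( *%R s^-1 @^-1` A))).
  congr (P _); apply/seteqP; split=> w /=; rewrite mulKf//.
by rewrite E.
Qed.

Lemma centered_scale (R : realType) (d : measure_display) (T : measurableType d)
  (P : probability T R) (X : {RV P >-> R}) (f : R -> R) (s : R) :
  has_density X f -> log_concave_fun f -> centered X ->
  centered (s *: (X : {mfun T >-> R}) : {RV P >-> R}).
Proof.
move=> Xf lc; rewrite /centered !expectation_def => cX.
have := integral_exprn_scale 1 s Xf lc.
by rewrite cX mule0.
Qed.

Local Close Scope classical_set_scope.

(* [moment_ratio] is invariant under X -> c X for c != 0, so the equality case
   is coincidence in law up to a nonzero scaling factor. *)
Theorem theorem5 (R : realType)
    (d : measure_display) (T : measurableType d) (P : probability T R)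
    (X : {RV P >-> R})
    (d' : measure_display) (T' : measurableType d') (P' : probability T' R)
    (Gamma : {RV P' >-> R})
    (q : nat) (p : R)
    (X_log_concave : log_concave X) (X_centered : centered X)
    (Gamma_density : has_density Gamma (@shifted_exponential_pdf R))
    (q_odd : odd q) (p_gt1 : 1 < p) (p_lt_q : p < q%:R) :
  (moment_ratio X q p <= moment_ratio Gamma q p)%E /\
  (moment_ratio X q p = moment_ratio Gamma q p <->
   exists2 c : R, c != 0 & same_law X (c *: (Gamma : {mfun T' >-> R}) : {RV P' >-> R})).
Proof.
have [f [Xf lc]] := X_log_concave.
have lg := log_concave_shifted_exponential R.
have p0 : 0 < p by lra.
have q0 : (0 < q)%N by case: q q_odd {p_lt_q}.
have q0' : 0 < q%:R^-1 :> R by rewrite invr_gt0 ltr0n.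
have [mX [nX [nX0 mXE nXE]]] := moments_finite q Xf lc p0.
have [mG [nG [nG0 mGE nGE]]] := moments_finite q Gamma_density lg p0.
(* the sign of the scaling makes the q-th moment nonnegative, as q is odd, and
   its size t gives X the p-th absolute moment of Gamma *)
pose sgn : R := if 0 <= mX then 1 else -1.
have sgnm : sgn ^+ q * mX = `|mX|.
  rewrite /sgn; case: ifPn => [m0|/negbTE m0]; first by rewrite expr1n mul1r ger0_norm.
  rewrite -signr_odd q_odd expr1 mulN1r ltr0_norm//.
  by rewrite ltNge m0.
have sgn1 : `|sgn| = 1 by rewrite /sgn; case: ifP; rewrite ?normrN normr1.
pose t := (nG / nX) `^ p^-1.
have t0 : 0 < t by rewrite powR_gt0// divr_gt0.
pose s := sgn * t.
have sN : `|s| = t by rewrite normrM sgn1 mul1r gtr0_norm.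
have s0 : s != 0 by rewrite -normr_gt0 sN.
pose Y : {RV P >-> R} := s *: (X : {mfun T >-> R}).
have Yf : has_density Y _ := has_density_scale s0 Xf.
have lY := log_concave_scale s0 lc.
have cY : centered Y := centered_scale s Xf lc X_centered.
pose mY := t ^+ q * `|mX|.
have mY0 : 0 <= mY by rewrite mulr_ge0// exprn_ge0// ltW.
have mYE : (\int[P]_w (Y w ^+ q)%:E = mY%:E)%E.
  by rewrite (integral_exprn_scale q s Xf lc) mXE -EFinM /s exprMn mulrAC sgnm mulrC.
have nYE : (\int[P]_w (`|Y w| `^ p)%:E = nG%:E)%E.
  rewrite integral_norm_powR_scale nXE sN /t -powRrM mulVf ?gt_eqF//.
  rewrite powRr1 ?divr_ge0 ?(ltW nX0) ?(ltW nG0)//.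
  by rewrite -EFinM divfK ?gt_eqF.
have ratioY : moment_ratio X q p = (mY `^ q%:R^-1 / nG `^ p^-1)%:E.
  rewrite -(moment_ratio_scale Xf lc q0 p0 s0).
  by rewrite (moment_ratioE nG0 mYE nYE) ger0_norm.
have ratioG := moment_ratioE nG0 mGE nGE.
have extremal : mG <= mY -> same_law Y Gamma.
  move=> le; apply: (shifted_exponential_extremal Yf lY cY Gamma_density q_odd p_gt1 p_lt_q).
    by rewrite nYE nGE.
  by rewrite mYE mGE lee_fin.
(* a larger q-th moment would force equal laws, hence equal moments *)
have mYG : mY <= mG.
  rewrite leNgt; apply/negP => lt; have := extremal (ltW lt) => YG.
  have Yg := same_law_density YG Gamma_density.
  have : (mY%:E = mG%:E)%E.
    rewrite -mYE -mGE (integral_density Yg (h := fun x => x ^+ q)); last exact: measurable_funX.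
    by rewrite (integral_density Gamma_density (h := fun x => x ^+ q))//; exact: measurable_funX.
  by move=> [E]; rewrite E ltxx in lt.
have mG0 : 0 <= mG by lra.
have nGp : 0 < nG `^ p^-1 by rewrite powR_gt0.
rewrite ratioY ratioG (ger0_norm mG0); split; [|split].
- rewrite lee_fin ler_pM2r ?invr_gt0//.
  by apply: ge0_ler_powR; rewrite ?nnegrE// ltW.
- move=> [/(divIf (lt0r_neq0 nGp)) E].
  have EYG : mY = mG.
    by apply: (powR_injective q0') => //; rewrite nnegrE.
  exists s^-1; first by rewrite invr_eq0.
  by apply: same_law_scale_inv => //; apply: extremal; rewrite EYG.
- move=> [c c0 XG].
  rewrite -ratioY -[in RHS](ger0_norm mG0) -ratioG.
  have cg := has_density_scale c0 Gamma_density.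
  rewrite -(moment_ratio_scale Gamma_density lg q0 p0 c0).
  exact: moment_ratio_density (same_law_density XG cg) cg.
Qed.
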